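(* For every integer $k\geqslant 3$, we have $t(k)\leqslant 1024\lceil \log_2 k+\log_2\log_2 k\rceil$.
   Context: Words are finite sequences of letters over a finite alphabet. A factor of a word $W$ is a word $F$ such that $W=AFB$ for some (possibly empty) words $A,B$. A tangram is a word in which every letter occurs an even number of times (possibly zero). The cut number $\mu(T)$ of a tangram $T$ is the least integer $k\geqslant 1$ such that $T=F_1F_2\cdots F_{k+1}$, where the $F_i$ are nonempty words satisfying $F_{\sigma(1)}\cdots F_{\sigma(j)}=F_{\sigma(j+1)}\cdots F_{\sigma(k+1)}$ for some permutation $\sigma$ of $\{1,2,\ldots,k+1\}$ and some $1\leqslant j\leqslant k$. By convention $\mu(W)=\infty$ if $W$ is not a tangram, and also if $W$ is the empty word. A word $W$ is $k$-tangram-free if every factor $F$ of $W$ satisfies $\mu(F)\geqslant k+1$. For $k\geqslant 1$, $t(k)$ denotes the least size of an alphabet over which there exist arbitrarily long $k$-tangram-free words. *)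

(* Defs.v *)
From mathcomp Require Import all_boot all_order all_algebra perm.
From mathcomp Require Import boolp constructive_ereal reals exp.

Set Implicit Arguments.
Unset Strict Implicit.
Unset Printing Implicit Defensive.

Import Order.TTheory GRing.Theory Num.Theory.

Local Open Scope ring_scope.

(* Values in [\bar int]: [+oo] when no natural number satisfies [P];
   [-oo] is never returned. *)
Definition least (P : nat -> Prop) : \bar int :=
  if pselect (exists n, `[< P n >]) is left exP then (ex_minn exP)%:Z%:E
  else +oo%E.

Definition tangram (A : finType) (W : seq A) : bool :=
  [forall a : A, ~~ odd (count_mem a W)].

(* [T] splits into [k+1] nonempty factors, indexed from 0, that can be
   rearranged by [s] so that the first [j] concatenate to the same word as the
   remaining [k+1-j]. *)
Definition cuttable (A : finType) (T : seq A) (k : nat) : Prop :=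
  exists (F : 'I_k.+1 -> seq A) (s : 'S_k.+1) (j : nat),
    [/\ forall i, F i != [::],
        T = \big[cat/[::]]_(i < k.+1) F i,
        (1 <= j <= k)%N &
        \big[cat/[::]]_(i < k.+1 | (i < j)%N) F (s i) =
        \big[cat/[::]]_(i < k.+1 | (j <= i)%N) F (s i)].

Definition cut_number (A : finType) (W : seq A) : \bar int :=
  if tangram W && (W != [::]) then least (fun k => (1 <= k)%N /\ cuttable W k)
  else +oo%E.

Definition tangram_free (A : finType) (k : nat) (W : seq A) : Prop :=
  forall F : seq A, infix F W -> (k.+1%:Z%:E <= cut_number F)%E.

(* The alphabet of size [n] is ['I_n]; the value is [+oo] if no finite alphabet
   admits arbitrarily long [k]-tangram-free words. *)
Definition t (k : nat) : \bar int :=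
  least (fun n => forall m : nat,
    exists W : seq 'I_n, (m <= size W)%N /\ tangram_free k W).

Definition log2 (R : realType) (x : R) : R := ln x / ln 2.

(* Main.v *)
(* Let a = ceil(log2 k + log2 log2 k), so that k^k <= 2^(2^a). Letters are pairs
   of a ruler letter min(nu_2(i), a-1) and a letter of a 1024-letter alphabet.
   The first coordinate alone makes every nonempty factor of length at most
   2^(a-1) have a letter of odd multiplicity. The second coordinate is chosen by
   Rosenfeld's counting argument to avoid every longer factor that at most k cuts
   rearrange into a square UU. A factor of length N = 2n of that kind is
   determined by U and by the positions of its pieces listed in rearranged order,
   hence by one of N^(k+1) * 1024^n data, and k^k <= 2^(2N) gives
   N^(k+1) <= 2^(7n) for N > 2^(a-1). Consequently each admissible word has at
   least 512 admissible one-letter extensions on average. *)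
Require Import Defs.
From mathcomp Require Import all_boot all_order all_algebra.
From mathcomp Require Import boolp constructive_ereal reals exp.
From mathcomp Require Import perm zify.
Import Order.TTheory GRing.Theory Num.Theory.

Set Implicit Arguments.
Unset Strict Implicit.
Unset Printing Implicit Defensive.

Local Open Scope nat_scope.

(** * Rearranging the factors of a word into a square *)

(** Unlike in [cuttable], the half [U] stands in place of the cut index [j], and indices are plain
    naturals, so that arbitrary letter maps preserve the property. *)
Definition rearranges (T : eqType) (k : nat) (y : seq T) : Prop :=
  exists (F : nat -> seq T) (g : nat -> nat) (U : seq T),
    [/\ forall i, i <= k -> F i != [::],
        y = flatten (mkseq F k.+1),
        perm_eq (mkseq g k.+1) (iota 0 k.+1) &
        flatten (mkseq (F \o g) k.+1) = U ++ U].

Lemma big_cat_mkseq (T : Type) (F : nat -> seq T) n :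
  \big[cat/[::]]_(i < n) F i = flatten (mkseq F n).
Proof.
elim: n => [|n IH]; first by rewrite big_ord0.
by rewrite big_ord_recr IH mkseqS -cats1 flatten_cat /= cats0.
Qed.

Lemma cuttable_rearranges (A : finType) (y : seq A) k :
  cuttable y k -> rearranges k y.
Proof.
case=> F [s [j [F0 -> /andP[j1 jk] E]]].
exists (fun i => F (inord i)), (fun i => val (s (inord i))),
  (\big[cat/[::]]_(i < k.+1 | i < j) F (s i)); split.
- by move=> i _; apply: F0.
- by rewrite -big_cat_mkseq; apply: eq_bigr => i _; rewrite inord_val.
- apply: uniq_perm; rewrite ?iota_uniq //.
    rewrite map_inj_in_uniq ?iota_uniq // => i i'; rewrite !mem_iota /= !add0n => hi hi'.
    by move/val_inj/perm_inj/(congr1 val) => /=; rewrite !inordK.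
  move=> i; rewrite mem_iota /= add0n; apply/mapP/idP => [[r _ ->]|hi]; first exact: ltn_ord.
  exists (val (s^-1%g (inord i))); first by rewrite mem_iota /= add0n.
  by rewrite inord_val permKV inordK.
rewrite [in X in _ ++ X]E.
pose H i := F (s (inord i)).
have -> : mkseq ((fun i => F (inord i)) \o (fun i => val (s (inord i)))) k.+1 = mkseq H k.+1.
  by apply: eq_mkseq => i /=; rewrite inord_val.
rewrite -big_cat_mkseq -(big_mkord xpredT H) (big_cat_nat (n := j)) ?leqW //=.
congr (_ ++ _).
  rewrite big_mkord (big_ord_widen_cond k.+1 xpredT H (leqW jk)).
  by apply: eq_big => i //= _; rewrite /H inord_val.
rewrite (big_nat_widenl _ 0) // big_mkord.
by apply: eq_big => i //= _; rewrite /H inord_val.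
Qed.

Lemma rearranges_map (T T' : eqType) (f : T -> T') k y :
  rearranges k y -> rearranges k (map f y).
Proof.
case=> F [g [U [F0 -> pg E]]].
exists (fun i => map f (F i)), g, (map f U); split=> //.
- by move=> i /F0; case: (F i).
- by rewrite map_flatten -map_comp.
- by rewrite -map_cat -E map_flatten -map_comp.
Qed.

(** * Coding a rearrangeable word by block starts and half of its letters *)

Definition offset (T : Type) (F : nat -> seq T) r := size (flatten (mkseq F r)).

Lemma offsetS (T : Type) (F : nat -> seq T) r :
  offset F r.+1 = offset F r + size (F r).
Proof. by rewrite /offset mkseqS -cats1 flatten_cat size_cat /= cats0. Qed.

Lemma leq_offset (T : Type) (F : nat -> seq T) r r' :
  r <= r' -> offset F r <= offset F r'.
Proof.
move/subnK <-; elim: (r' - r) => //= n IH; rewrite addSn offsetS.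
exact: leq_trans IH (leq_addr _ _).
Qed.

Lemma offsetP (T : Type) (F : nat -> seq T) n i : i < offset F n ->
  exists2 r, r < n & offset F r <= i < offset F r.+1.
Proof.
elim: n => // n IH; case: (ltnP i (offset F n)) => [/IH[r rn ir] _|ni iSn].
  by exists r; rewrite // ltnW.
by exists n; rewrite ?ni.
Qed.

Lemma nth_flatten_offset (T : Type) (F : nat -> seq T) x0 n r c :
  r < n -> c < size (F r) ->
  nth x0 (flatten (mkseq F n)) (offset F r + c) = nth x0 (F r) c.
Proof.
move=> rn cr; rewrite -(subnKC rn) /mkseq iotaD map_cat flatten_cat nth_cat.
rewrite -/(mkseq F r.+1) -/(offset F r.+1) offsetS ltn_add2l cr.
by rewrite mkseqS -cats1 flatten_cat /= cats0 nth_cat -/(offset F r) ltnNge leq_addr /= addKn.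
Qed.

(* With block starts [d] in a word of length [N], the positions of the block
   starting at [p]. *)
Definition block (N : nat) (d : seq nat) (p : nat) : seq nat :=
  [seq i <- iota p (N - p) | ~~ has (fun q => p < q <= i) d].

(* The word [y] of length [size v] whose blocks, read in the order of their
   starts in [d], spell [v]. *)
Definition reassemble (T : Type) (x0 : T) (d : seq nat) (v : seq T) : seq T :=
  let N := size v in
  mkseq (fun i => nth x0 v (index i (flatten (map (block N d) d)))) N.

(** Factors are nonempty, so the first start after [offset F r] is [offset F r.+1], or the word ends
    there if [r = k]. Only the set of starts matters, not their order or repetitions in [d]. *)
Lemma block_offset (T : eqType) (F : nat -> seq T) k d r :
  (forall i, i <= k -> F i != [::]) -> d =i mkseq (offset F) k.+1 -> r <= k ->
  block (offset F k.+1) d (offset F r) = iota (offset F r) (size (F r)).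
Proof.
move=> F0 dE rk; apply: (irr_sorted_eq ltn_trans ltnn).
- by apply: sorted_filter; [exact: ltn_trans|exact: iota_ltn_sorted].
- exact: iota_ltn_sorted.
have rS : offset F r.+1 <= offset F k.+1 by apply: leq_offset.
have r0 : offset F r <= offset F k.+1 by apply: leq_offset; apply: leqW.
move=> i; rewrite mem_filter !mem_iota subnKC // -offsetS.
case: (leqP (offset F r) i) => //= ri; last by rewrite andbF.
apply/andP/idP => [[/hasPn H iN]|iS].
  rewrite ltnNge; apply/negP => Si; case: (ltngtP r k) rk => // [rk|rk] _.
    have /H : offset F r.+1 \in d.
      by rewrite dE; apply: map_f; rewrite mem_iota.
    rewrite Si andbT offsetS -leqNgt -[leqRHS]addn0 leq_add2l leqn0.
    by rewrite size_eq0 (negPf (F0 _ (ltnW rk))).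
  by move: iN; rewrite -rk ltnNge Si.
split; last exact: leq_trans iS rS.
apply/hasPn => q; rewrite dE => /mapP[r' _ ->]; apply/negP => /andP[rr' r'i].
case: (leqP r' r) => [/(leq_offset F)|/(leq_offset F)].
  by rewrite leqNgt rr'.
by rewrite leqNgt (leq_ltn_trans r'i iS).
Qed.

Lemma map_nth_iota_offset (T : Type) (F : nat -> seq T) x0 n r :
  r < n ->
  [seq nth x0 (flatten (mkseq F n)) i | i <- iota (offset F r) (size (F r))] = F r.
Proof.
move=> rn; rewrite -[offset F r]addn0 iotaDl -map_comp.
rewrite -[RHS](mkseq_nth x0); apply/eq_in_map => c.
by rewrite mem_iota /= add0n => cr; apply: nth_flatten_offset.
Qed.

(** [U ++ U] lists the letters of [y] in the order in which [d] visits its blocks, so looking up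
    each position in that visiting order restores [y]. Fixing the length [k.+1] puts all [k' <= k]
    into one code space. *)
Lemma rearranges_code (T : eqType) (x0 : T) k k' (y : seq T) :
  k' <= k -> rearranges k' y ->
  exists d U, [/\ size d = k.+1, all (gtn (size y)) d, {subset U <= y},
    size y = (size U).*2 & y = reassemble x0 d (U ++ U)].
Proof.
move=> kk [F [g [U [F0 yE pg UE]]]].
have gk r : r <= k' -> g r <= k'.
  move=> rk; have : g r \in mkseq g k'.+1 by apply: map_f; rewrite mem_iota.
  by rewrite (perm_mem pg) mem_iota.
pose d0 := mkseq (offset F \o g) k'.+1.
(* The padding repeats a start already present, so the set of starts, and with it every block, is
   unchanged. *)
pose d := d0 ++ nseq (k - k') (offset F (g 0)).
have dE : d =i mkseq (offset F) k'.+1.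
  move=> p; rewrite mem_cat mem_nseq.
  have -> : (p \in d0) = (p \in mkseq (offset F) k'.+1).
    rewrite /d0 /mkseq map_comp; apply: perm_mem.
    by apply: perm_map; exact: pg.
  apply/orP/idP => [[//|/andP[_ /eqP->]]|]; last by left.
  by apply: map_f; rewrite mem_iota ltnS gk.
have yN : size y = offset F k'.+1 by rewrite yE.
have ySz : size y = (size U).*2.
  rewrite -addnn -size_cat -UE yE !size_flatten !sumnE.
  apply/perm_big/perm_map; rewrite perm_sym /mkseq map_comp.
  exact: perm_map.
exists d, U; split=> //.
- by rewrite size_cat size_mkseq size_nseq addSn subnKC.
- apply/allP => p; rewrite dE => /mapP[r]; rewrite mem_iota /= add0n ltnS => rk -> /=.
  rewrite yN; apply: leq_trans (leq_offset F (_ : r.+1 <= _)) => //.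
  by rewrite offsetS -addn1 leq_add2l lt0n size_eq0 F0.
- move=> c cU; have : c \in flatten (mkseq (F \o g) k'.+1) by rewrite UE mem_cat cU.
  case/flattenP => _ /mapP[r + ->] cr; rewrite mem_iota /= add0n ltnS => /gk rk.
  rewrite yE; apply/flattenP; exists (F (g r)) => //.
  by apply: map_f; rewrite mem_iota.
have UUN : size (U ++ U) = size y by rewrite size_cat addnn.
rewrite /reassemble UUN -[LHS](mkseq_nth x0); apply/eq_in_map => i.
rewrite mem_iota add0n => /andP[_ iN].
have -> : map (block (size y) d) d = map (block (size y) d) d0 ++
    map (block (size y) d) (nseq (k - k') (offset F (g 0))) by rewrite -map_cat.
rewrite flatten_cat; set I := flatten (map _ d0).
have IE : I = flatten (mkseq (fun r => iota (offset F (g r)) (size (F (g r)))) k'.+1).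
  rewrite /I /d0 /mkseq -map_comp; congr flatten; apply/eq_in_map => r.
  rewrite mem_iota /= add0n ltnS => /gk rk.
  by rewrite yN block_offset.
have iI : i \in I.
  rewrite IE; move: iN; rewrite yN => /offsetP[r rk ir].
  have : r \in mkseq g k'.+1 by rewrite (perm_mem pg) mem_iota.
  case/mapP => q qk rE; apply/flattenP; exists (iota (offset F (g q)) (size (F (g q)))).
    exact: (map_f (fun r => iota (offset F (g r)) (size (F (g r))))).
  by rewrite mem_iota -offsetS -rE.
have nthI : map (nth x0 y) I = U ++ U.
  rewrite -UE IE map_flatten /mkseq -map_comp; congr flatten.
  apply/eq_in_map => r; rewrite mem_iota /= add0n ltnS => /gk rk.
  by rewrite yE map_nth_iota_offset.
(* [index] finds the first occurrence, which lies in [I], so the padding is never consulted. *)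
by rewrite index_cat iI -nthI (nth_map 0) ?index_mem // nth_index.
Qed.

(** * The truncated ruler sequence *)

Definition ruler (b i : nat) : nat := minn (logn 2 i) b.

(* The largest letter of a short factor occurs once: between two multiples of
   [2 ^ e] that are not multiples of [2 ^ e.+1] lies a multiple of [2 ^ e.+1]. *)
Lemma ruler_odd_count (b p N : nat) : 0 < p -> 0 < N <= 2 ^ b ->
  exists e, count_mem e [seq ruler b i | i <- iota p N] = 1.
Proof.
move=> p0 /andP[N0 Nb].
pose P e := e \in [seq ruler b i | i <- iota p N].
have Pb e : P e -> e <= b by case/mapP => i _ ->; apply: geq_minr.
have exP : exists e, P e.
  by exists (ruler b p); apply: map_f; rewrite mem_iota leqnn -[ltnLHS]addn0 ltn_add2l.
case: (ex_maxnP exP Pb) => e /mapP[i iN eE] emax; exists e.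
have sep x z : x \in iota p N -> z \in iota p N -> ruler b x = e -> ruler b z = e ->
  ~ x < z.
  rewrite !mem_iota => /andP[px xN] /andP[pz zN] xe ze xz.
  have [dx dz] : 2 ^ e %| x /\ 2 ^ e %| z.
    split; rewrite pfactor_dvdn //; try lia.
      by rewrite -xe geq_minl.
    by rewrite -ze geq_minl.
  have dzx : 2 ^ e %| z - x by rewrite dvdn_sub.
  have le1 : 2 ^ e <= z - x by apply: dvdn_leq; rewrite ?subn_gt0.
  (* Since [2 ^ e <= z - x < N <= 2 ^ b], the cap [b] is not reached and [e] is the exact valuation
     of [x]. *)
  have eb : e < b by rewrite -(@ltn_exp2l 2) //; lia.
  have /emax : P (ruler b (x + 2 ^ e)) by apply: map_f; rewrite mem_iota; lia.
  rewrite leqNgt => /negP[]; rewrite leq_min eb andbT -pfactor_dvdn //; last lia.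
  have lx : logn 2 x = e by move: xe; rewrite /ruler; lia.
  have [m cm xE] := pfactor_coprime (isT : prime 2) (leq_trans p0 px).
  rewrite lx in xE; rewrite [x]xE -mulSnr expnS dvdn_pmul2r ?expn_gt0 //.
  by rewrite dvdn2 /= negbK -coprime2n.
have uniqE z : z \in iota p N -> (ruler b z == e) = (z == i).
  move=> zN; apply/eqP/eqP => [ze|->//].
  by case: (ltngtP z i) => // h; [case: (sep z i)|case: (sep i z)].
rewrite count_map (eq_in_count (a2 := pred1 i)); last by move=> z /uniqE.
by rewrite count_uniq_mem ?iota_uniq // iN.
Qed.

(** * Estimates for the counting argument *)

(** With [N = n.*2], raising [N <= k * 2 ^ (N %/ k)] to the power [k] gives
    [N ^ k <= k ^ k * 2 ^ N <= 2 ^ (6 * n)]; moreover [N <= 2 ^ n]. The factor [2 ^ n] on the left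
    makes the resulting bounds summable over [n]. *)
Lemma expn_bound (k a n : nat) : 0 < k -> k ^ k <= 2 ^ (2 ^ a) -> 2 ^ a <= n.*2.*2 ->
  0 < n ->
  n.*2 ^ k.+1 * 2 ^ n <= 2 ^ (8 * n).
Proof.
move=> k0 kk an n0; set N := n.*2.
have h1 : N <= k * 2 ^ (N %/ k).
  apply: leq_trans (ltnW (ltn_ceil N k0)) _; rewrite mulnC leq_mul2l.
  by rewrite ltn_expl ?orbT.
have h2 : N ^ k <= 2 ^ (6 * n).
  apply: leq_trans (_ : (k * 2 ^ (N %/ k)) ^ k <= _); first by rewrite leq_exp2r.
  rewrite expnMn -expnM (_ : 6 * n = n.*2.*2 + N); last lia.
  rewrite expnD leq_mul //.
    by apply: leq_trans kk _; rewrite leq_exp2l.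
  by rewrite leq_exp2l // leq_divM.
have h3 : N <= 2 ^ n.
  rewrite /N -mul2n -(prednK n0) expnS leq_mul2l /=; exact: ltn_expl.
rewrite expnS (_ : 8 * n = n + 6 * n + n); last lia.
by rewrite 2!expnD; exact: leq_mul (leq_mul h3 h2) (leqnn _).
Qed.

Lemma dyadic_sum_bound (f : nat -> nat) (X m : nat) :
  (* The sum is in fact at most [X - X / 2 ^ m]; the induction proves this form, cleared of division
     and subtraction. *)
  (forall n, 0 < n <= m -> f n * 2 ^ n <= X) -> \sum_(1 <= n < m.+1) f n <= X.
Proof.
move=> H; suff : (\sum_(1 <= n < m.+1) f n) * 2 ^ m + X <= X * 2 ^ m.
  have := expn_gt0 2 m; rewrite /= => m0; nia.
elim: m H => [|m IH] H; first by rewrite big_geq // mul0n muln1.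
have {}IH := IH (fun n h => H n ltac:(lia)).
rewrite big_nat_recr //= mulnDl expnS.
have := H m.+1 ltac:(lia); rewrite expnS; nia.
Qed.

(** * Rosenfeld's counting argument *)

Fixpoint words (T : Type) (s : seq T) (n : nat) : seq (seq T) :=
  if n is m.+1 then [seq x :: w | x <- s, w <- words s m] else [:: [::]].

Lemma size_words (T : Type) (s : seq T) n : size (words s n) = size s ^ n.
Proof. by elim: n => //= n IH; rewrite size_allpairs IH expnS. Qed.

Lemma mem_words (T : eqType) (s w : seq T) : all [in s] w -> w \in words s (size w).
Proof.
elim: w => //= x w IH /andP[xs /IH ws].
by apply/allpairsP; exists (x, w).
Qed.

Section Counting.

Variables (T : eqType) (x0 : T) (s : seq T) (k L : nat).

(** Only factors longer than [L] are constrained; the ruler coordinate takes care of the shorter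
    ones. *)
Definition avoids (x : seq T) : Prop :=
  forall y k', infix y x -> L < size y -> k' <= k -> ~ rearranges k' y.

Fixpoint avoiders (n : nat) : seq (seq T) :=
  if n is m.+1 then
    [seq x <- [seq rcons w c | w <- avoiders m, c <- s] | `[< avoids x >]]
  else [:: [::]].

Lemma avoids_catl (x y : seq T) : avoids (x ++ y) -> avoids x.
Proof.
move=> H z k' zx; apply: H.
by case/infixP: zx => p [q ->]; apply/infixP; exists p, (q ++ y); rewrite !catA.
Qed.

Lemma avoidersP n (x : seq T) :
  reflect [/\ size x = n, all [in s] x & avoids x] (x \in avoiders n).
Proof.
elim: n x => [|n IH] x /=.
  rewrite inE; apply: (iffP eqP) => [->|[/size0nil->]//].
  by split=> // y k' /infixP[p [q]] /esym; case: p; case: y; case: q.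
rewrite mem_filter; apply: (iffP andP) => [[/asboolP ax]|[+ +]].
  case/allpairsP => -[w c] /= [/IH[<- ws _] cs xE].
  by rewrite xE size_rcons all_rcons [c \in s]cs ws -xE.
case/lastP: x => // w c; rewrite size_rcons all_rcons => -[wn] /andP[cs ws] ax.
split; first exact/asboolP.
apply/allpairsP; exists (w, c); split=> //; apply/IH; split=> //.
by apply: (@avoids_catl _ [:: c]); rewrite cats1.
Qed.

Hypothesis us : uniq s.

Lemma uniq_avoiders n : uniq (avoiders n).
Proof.
elim: n => //= n IH; apply: filter_uniq.
by apply: allpairs_uniq => // -[w c] [w' c'] _ _ /= /rcons_inj[-> ->].
Qed.

(* Candidates for the extensions of words of [avoiders m] that become bad because
   of a suffix of length [n.*2]: a suffix is coded by its block starts in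
   rearranged order and half of its letters. *)
Definition failures (m n : nat) : seq (seq T) :=
  if (L < n.*2 <= m.+1) then
    [seq w ++ v | w <- avoiders (m.+1 - n.*2),
       v <- [seq reassemble x0 d (U ++ U) | d <- words (iota 0 n.*2) k.+1, U <- words s n]]
  else [::].

(** Without its last letter [x] avoids, so an offending factor is a suffix. That suffix has a code
    by [rearranges_code], and what precedes it is a prefix of an avoider. *)
Lemma mem_failures m (x : seq T) :
  x \in [seq rcons w c | w <- avoiders m, c <- s] -> ~ avoids x ->
  exists2 n, 0 < n <= m.+1 & x \in failures m n.
Proof.
case/allpairsP => -[w c] /= [/avoidersP[wm ws aw] cs xE] nx.
have [y [k' [yx Ly kk ry]]] : exists y k',
    [/\ infix y x, L < size y, k' <= k & rearranges k' y].
  by apply: contrapT => H; apply: nx => y k' yx Ly kk ry; apply: H; exists y, k'.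
have [p xpy] : exists p, x = p ++ y.
  case/infixP: yx => p [q]; case/lastP: q => [|q b]; first by rewrite cats0; exists p.
  rewrite xE -!rcons_cat => /rcons_inj[wE _].
  by case: (aw y k' _ Ly kk ry); apply/infixP; exists p, q.
have [d [U [dk dy Uy yU yE]]] := rearranges_code x0 kk ry.
have xm : size x = m.+1 by rewrite xE size_rcons wm.
have xs : all [in s] x by rewrite xE all_rcons [c \in s]cs ws.
have pm : size p = m.+1 - size y by rewrite -xm xpy size_cat addnK.
have ym : size y <= m.+1 by rewrite -xm xpy size_cat leq_addl.
have y0 : 0 < size y by apply: leq_ltn_trans Ly.
have Us : all [in s] U.
  apply/allP => e /Uy ey; apply: (allP xs).
  by rewrite xpy mem_cat ey orbT.
exists (size U); first by move: y0 ym; rewrite yU; lia.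
rewrite /failures -yU Ly ym.
rewrite xpy; apply: allpairs_f.
  apply/avoidersP; split=> //; first by move: xs; rewrite xpy all_cat => /andP[].
  apply: (@avoids_catl p (take (size w - size p) y)).
  have pw : size p <= size w by rewrite pm wm; lia.
  have -> : p ++ take (size w - size p) y = take (size w) x.
    by rewrite xpy take_cat ltnNge pw.
  by rewrite xE -cats1 take_size_cat.
rewrite {1}yE; apply: allpairs_f; last exact: mem_words.
rewrite -dk; apply: mem_words; apply: sub_all dy => i /=.
by rewrite mem_iota.
Qed.

Lemma size_failures m n :
  size (failures m n) <=
  if L < n.*2 <= m.+1
  then size (avoiders (m.+1 - n.*2)) * (n.*2 ^ k.+1 * size s ^ n) else 0.
Proof.
rewrite /failures; case: ifP => // _.
by rewrite 2!size_allpairs !size_words size_iota.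
Qed.

(** Union bound: each one-letter extension avoids or occurs in some [failures m n]. *)
Lemma size_avoiders_ext m :
  size (avoiders m) * size s <=
  size (avoiders m.+1) + \sum_(1 <= n < m.+2) size (failures m n).
Proof.
rewrite /= -(size_allpairs (@rcons T)) -(count_predC (fun x => `[< avoids x >])) -!size_filter leq_add2l.
pose r := flatten [seq failures m n | n <- index_iota 1 m.+2].
have -> : \sum_(1 <= n < m.+2) size (failures m n) = size r.
  by rewrite size_flatten /shape -map_comp sumnE big_map.
apply: uniq_leq_size.
  apply: filter_uniq.
  apply: allpairs_uniq (uniq_avoiders m) us _ => -[w c] [w' c'] _ _ /= /rcons_inj[-> ->] //.
move=> x; rewrite mem_filter => /andP[/asboolP nx /mem_failures H].
case: (H nx) => n nm xn; apply/flattenP; exists (failures m n) => //.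
by apply: map_f; rewrite mem_index_iota.
Qed.

Hypotheses (ss : size s = 2 ^ 10).
Hypothesis code_bound :
  forall n, L < n.*2 -> n.*2 ^ k.+1 * 2 ^ n <= 2 ^ (8 * n).

(** By induction, going back [j] letters divides the number of avoiders by at least [2 ^ (9 * j)],
    so [failures m n] has size at most [2 ^ 9 * size (avoiders m) / 2 ^ n]. Summed over [n], this is
    at most half of the [2 ^ 10 * size (avoiders m)] extensions. *)
Lemma avoiders_growth m : 2 ^ 9 * size (avoiders m) <= size (avoiders m.+1).
Proof.
elim/ltn_ind: m => m IH.
have growth j : j <= m -> 2 ^ (9 * j) * size (avoiders (m - j)) <= size (avoiders m).
  elim: j => [|j IHj] jm; first by rewrite subn0 mul1n.
  apply: leq_trans (IHj (ltnW jm)).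
  rewrite mulnS addnC expnD -mulnA leq_mul2l orbC.
  by rewrite (_ : m - j = (m - j.+1).+1) ?IH //; lia.
suff : \sum_(1 <= n < m.+2) size (failures m n) <= 2 ^ 9 * size (avoiders m).
  move=> H; have := size_avoiders_ext m; rewrite ss (expnD 2 1 9) expn1.
  move: H; move: (2 ^ 9) => b; nia.
apply: dyadic_sum_bound => n /andP[n0 nm].
apply: leq_trans (leq_mul (size_failures m n) (leqnn _)) _.
case: ifP => // /andP[Ln n2m].
have := growth (n.*2).-1 ltac:(lia).
rewrite (_ : m - n.*2.-1 = m.+1 - n.*2); last lia.
set A := size (avoiders (m.+1 - _)) => gA.
apply: leq_trans (_ : A * (2 ^ (8 * n) * 2 ^ (10 * n)) <= _).
  rewrite -mulnA leq_mul2l ss -expnM mulnAC; apply/orP; right.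
  by rewrite leq_mul2r code_bound ?orbT.
(* Removing [n.*2] letters from length [m.+1] goes back only [n.*2.-1] from length [m], which leaves
   one factor [2 ^ 9]. *)
rewrite -expnD (_ : 8 * n + 10 * n = 9 + 9 * n.*2.-1); last lia.
by rewrite expnD mulnC -mulnA leq_mul2l gA orbT.
Qed.

Lemma avoiders_exist m : exists2 x, size x = m & all [in s] x /\ avoids x.
Proof.
have : 0 < size (avoiders m).
  elim: m => // m IH; apply: leq_trans (avoiders_growth m).
  by rewrite muln_gt0 expn_gt0.
case E: (avoiders m) => [//|x r] _; exists x.
  by have /avoidersP[] : x \in avoiders m by rewrite E mem_head.
by have /avoidersP[] : x \in avoiders m by rewrite E mem_head.
Qed.

End Counting.

(** * Tangram-free words over paired letters *)

(** The count of [P] is a sum of even letter counts; thus evenness passes to the coordinates of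
    letters. *)
Lemma tangram_count_even (A : finType) (W : seq A) (P : pred A) :
  tangram W -> ~~ odd (count P W).
Proof.
move/forallP => TW; rewrite -sum1_count (partition_big id P) //=.
apply: (big_ind (fun n => ~~ odd n)) => // [n n' /negPf on /negPf on'|c Pc].
  by rewrite oddD on on'.
rewrite (eq_bigl (pred1 c)) ?sum1_count // => i.
by rewrite /=; case: eqP => [->|]; rewrite ?Pc ?andbF ?eqxx.
Qed.

Lemma bounded_lift (n : nat) (v : seq nat) :
  all (gtn n) v -> exists W : seq 'I_n, map val W = v.
Proof.
elim: v => [|i v IH]; first by exists [::].
by case/andP => lt_in /IH[W <-]; exists (Ordinal lt_in :: W).
Qed.

Lemma least_le (P : nat -> Prop) n : P n -> (least P <= n%:Z%:E)%E.
Proof.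
rewrite /least => Pn; case: pselect => [exP|[]]; last by exists n; apply/asboolP.
by case: ex_minnP => m _ min_m; rewrite lee_fin lez_nat min_m //; apply/asboolP.
Qed.

Lemma tangram_freeP (A : finType) k (W : seq A) :
  (forall F k', infix F W -> F != [::] -> tangram F -> cuttable F k' -> k < k') ->
  tangram_free k W.
Proof.
move=> H F FW; rewrite /cut_number; case: ifP => [/andP[TF F0]|_]; last exact: leey.
rewrite /least; case: pselect => [exP|_]; last exact: leey.
case: ex_minnP => m /asboolP[_ cm] _; rewrite lee_fin lez_nat.
exact: (H F).
Qed.

(** Here [a.+1] is the exponent called a in the overview: there are [a.+1] ruler letters, and the
    threshold [L] is [2 ^ a]. *)
Lemma tangram_free_words_exist (k a m : nat) : 0 < k -> k ^ k <= 2 ^ 2 ^ a.+1 ->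
  exists W : seq 'I_(1024 * a.+1), m <= size W /\ tangram_free k W.
Proof.
move=> k0 kk.
have code_bound n : 2 ^ a < n.*2 -> n.*2 ^ k.+1 * 2 ^ n <= 2 ^ (8 * n).
  move=> an; apply: (expn_bound k0 kk); last by rewrite -double_gt0; case: n.*2 an.
  by rewrite expnS mul2n leq_double ltnW.
have s1024 : size (iota 0 1024) = 2 ^ 10 by rewrite size_iota.
have [x xm [xs ax]] := avoiders_exist 0 (iota_uniq 0 1024) s1024 code_bound m.
(* A pair is stored as quotient and remainder by 1024. The ruler is read from 1 on, because
   [logn 2 0] is 0 by default. *)
pose v := [seq ruler a i.+1 * 1024 + nth 0 x i | i <- iota 0 m].
have x1024 i : i < m -> nth 0 x i < 1024.
  move=> im; have /(allP xs) : nth 0 x i \in x by rewrite mem_nth ?xm.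
  by rewrite mem_iota.
have /bounded_lift[W WE] : all (gtn (1024 * a.+1)) v.
  apply/allP => _ /mapP[i + ->]; rewrite mem_iota add0n => /andP[_ im] /=.
  have := x1024 i im; have : ruler a i.+1 <= a by apply: geq_minr.
  lia.
have Wx : [seq val c %% 1024 | c <- W] = x.
  rewrite (map_comp (modn^~ 1024) val) WE -map_comp -[RHS](mkseq_nth 0) xm.
  apply/eq_in_map => i; rewrite mem_iota add0n => /andP[_ im] /=.
  by rewrite modnMDl modn_small ?x1024.
have Wr : [seq val c %/ 1024 | c <- W] = [seq ruler a i | i <- iota 1 m].
  rewrite (map_comp (divn^~ 1024) val) WE -map_comp -[1]addn0 iotaDl -map_comp.
  apply/eq_in_map => i; rewrite mem_iota add0n => /andP[_ im] /=.
  by rewrite divnMDl // divn_small ?x1024 // addn0.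
have Wm : size W = m by rewrite -(size_map (fun c => val c %% 1024)) Wx.
exists W; split; first by rewrite Wm.
apply: tangram_freeP => F k' /infixP[p [q WF]] F0 TF /cuttable_rearranges.
move/(rearranges_map (fun c => val c %% 1024)) => rF.
(* A long factor contradicts avoidance in the second coordinate; in a short one some ruler letter
   occurs exactly once, against evenness. *)
rewrite ltnNge; apply/negP => kk'; case: (ltnP (2 ^ a) (size F)) => Fa.
  apply: ax kk' rF; last by rewrite size_map.
  by apply/infixP; rewrite -Wx WF !map_cat; do 2 eexists.
have [e] := @ruler_odd_count a (size p).+1 (size F) isT ltac:(by rewrite lt0n size_eq0 F0).
suff -> : [seq ruler a i | i <- iota (size p).+1 (size F)] = [seq val c %/ 1024 | c <- F].
  by rewrite count_map => ce; have : ~~ odd 1 by rewrite -ce tangram_count_even.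
have : take (size F) (drop (size p) [seq val c %/ 1024 | c <- W]) = [seq val c %/ 1024 | c <- F].
  by rewrite -map_drop -map_take WF drop_size_cat // take_size_cat.
rewrite Wr -map_drop -map_take drop_iota take_iota => <-.
congr (map _ (iota _ _)); apply/esym/minn_idPl.
by rewrite -Wm WF !size_cat addKn leq_addr.
Qed.

Local Open Scope ring_scope.

(** * From the logarithmic bound to a double exponential *)

(** Exponentiating [log2 k + log2 (log2 k) <= a.+1] gives [k * log2 k <= 2 ^ a.+1], whose left side
    is the base-2 logarithm of [k ^ k]. For [3 <= k] both summands are positive, so the ceiling is a
    successor. *)
Lemma ceil_log2_bound (R : realType) (k : nat) : (3 <= k)%N ->
  exists2 a : nat, Num.ceil (log2 (k%:R : R) + log2 (log2 (k%:R : R))) = a.+1%:Z &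
    (k ^ k <= 2 ^ (2 ^ a.+1))%N.
Proof.
move=> k3; set x : R := k%:R.
have ln2 : 0 < ln (2 : R) by rewrite ln_gt0 // ltr1n.
have k0 : 0 < x by rewrite ltr0n; lia.
have lx : 1 < log2 x.
  by rewrite /log2 ltr_pdivlMr // mul1r ltr_ln ?posrE // (ltr_nat R 2 k).
have llx : 0 < log2 (log2 x) by rewrite /log2 divr_gt0 // ln_gt0.
have lx0 := lt_trans ltr01 lx.
set c := Num.ceil _.
have c0 : 0 < c by rewrite ceil_gt0 addr_gt0.
have [a ca] : exists a : nat, c = a.+1%:Z by exists `|c|%N.-1; lia.
exists a => //.
have /(ler_wpM2r (ltW ln2)) : log2 x + log2 (log2 x) <= a.+1%:R.
  by rewrite -[a.+1%:R]/(a.+1%:Z%:~R) -ca ceil_ge.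
rewrite mulrDl /log2 !divfK ?gt_eqF // -/(log2 x) mulr_natl -lnXn // -lnM ?posrE //.
rewrite ler_ln ?posrE ?(mulr_gt0 k0 lx0) ?exprn_gt0 // => kla.
have ME : (2 ^ a.+1)%N%:R = 2 ^+ a.+1 :> R by rewrite natrX.
move: (2 ^ a.+1)%N ME => M ME.
rewrite -(ler_nat R) (natrX R k k) (natrX R 2 M) -/x.
rewrite -ler_ln ?posrE ?exprn_gt0 // (lnXn _ k0) (lnXn _ (ltr0n R 2)).
rewrite -(mulr_natr _ M) ME -(mulr_natl _ k) -/x.
by rewrite [leRHS]mulrC -ler_pdivrMr // -mulrA.
Qed.

Theorem theorem1 (R : realType) (k : nat) (hk : (3 <= k)%N) :
  (t k <= (1024 * Num.ceil (log2 (k%:R : R) + log2 (log2 (k%:R : R))))%:E)%E.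
Proof.
have [a -> kk] := ceil_log2_bound R hk.
rewrite -[1024 * _]/((1024 * a.+1)%N%:Z).
apply: least_le => m; apply: tangram_free_words_exist kk; exact: leq_trans hk.
Qed.
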